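(* For every integer $n \geq 4.5 \times 10^{36}$ that is divisible by $4$, there exists an $MH(n,7)$.
   Context: For positive integers $n, m$, an $MH(n,m)$ (an $m$-modular Hadamard matrix of size $n$) is an $n \times n$ matrix $H$ with all entries in $\{+1,-1\}$ such that $HH^\top \equiv nI \pmod{m}$ (entrywise), where $I$ is the identity matrix. *)

(* Defs.v *)
From mathcomp Require Import all_boot all_order all_algebra.

Set Implicit Arguments.
Unset Strict Implicit.
Unset Printing Implicit Defensive.

Import GRing.Theory.

Local Open Scope ring_scope.

(* The matrix has integer entries, so that H H^T is computed in int and only
   then compared with n I, entry by entry, modulo m. *)
Definition is_MH (n m : nat) (H : 'M[int]_n) : Prop :=
  (forall i j : 'I_n, H i j = 1 \/ H i j = -1) /\
  (forall i j : 'I_n,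
     ((H *m H^T) i j = (n%:Z *: (1%:M : 'M[int]_n)) i j %[mod m%:Z])%Z).

(* Main.v *)
(* Write n = 4m and feed the Williamson array with four commuting symmetric
   matrices A_t = J - 2 X_t, where J is all-ones and X_t is a 0/1 matrix with
   constant row sum x_t mod 7.  It yields an MH(4m, 7) as soon as
   sum X_t^2 = m I and sum x_t = m mod 7, conditions which depend on m only
   mod 7 and are preserved by block-diagonal sums.
   If m mod 7 <= 4, take each X_t to be 0 or I.  If m mod 7 = 5 + w with
   w in {0, 1}, there are circulant solutions of sizes 7 and 12 with the same
   row sums (w, 2, 5, 5), and every m >= 66 has the form 7a + 12b. *)

Require Import Defs.
From mathcomp Require Import all_boot all_order all_algebra.
From mathcomp Require Import zify ring.

Set Implicit Arguments.
Unset Strict Implicit.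
Unset Printing Implicit Defensive.

Import GRing.Theory.

Local Open Scope ring_scope.

(** * The Williamson array *)

Section Williamson.
Variables (R : comPzRingType) (k : nat).
Implicit Types A X : 'I_4 -> 'M[R]_k.

Definition williamson A : 'M[R]_(k + k + (k + k)) :=
  let a := A 0 in let b := A 1 in let c := A 2%:R in let d := A 3%:R in
  block_mx (block_mx a b (- b) a) (block_mx c d (- d) c)
           (block_mx (- c) d (- d) (- c)) (block_mx a (- b) b a).

Lemma williamson_entries A :
  (forall t i j, A t i j = 1 \/ A t i j = -1) ->
  forall i j, williamson A i j = 1 \/ williamson A i j = -1.
Proof.
move=> hA.
have hN t i j : - A t i j = 1 \/ - A t i j = -1.
  by case: (hA t i j) => ->; [right | left; rewrite opprK].
move=> i j; rewrite /williamson.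
case: (split_ordP i) => {i}i ->; case: (split_ordP i) => {i}i ->;
  case: (split_ordP j) => {j}j ->; case: (split_ordP j) => {j}j ->;
  by rewrite ?(block_mxEul, block_mxEur, block_mxEdl, block_mxEdr) ?mxE.
Qed.

(** By symmetry the diagonal blocks of the product are the sum of the squares; by commutation the
    terms of every other block cancel in pairs. *)
Lemma williamson_mul_tr A c :
  (forall t, (A t)^T = A t) -> (forall s t, A s *m A t = A t *m A s) ->
  \sum_t A t *m A t = c%:M ->
  williamson A *m (williamson A)^T = c%:M.
Proof.
move=> hT hC; rewrite !big_ord_recl big_ord0 addr0.
rewrite /williamson.
have -> : ord0 = 0 :> 'I_4 by [].
have -> : lift ord0 ord0 = 1 :> 'I_4 by apply/val_inj.
have -> : lift ord0 (lift ord0 ord0) = 2%:R :> 'I_4 by apply/val_inj.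
have -> : lift ord0 (lift ord0 (lift ord0 ord0)) = 3%:R :> 'I_4
  by apply/val_inj.
move: (A 0) (A 1) (A 2%:R) (A 3%:R) (hT 0) (hT 1) (hT 2%:R) (hT 3%:R)
  (hC 1 0) (hC 2%:R 0) (hC 3%:R 0) (hC 2%:R 1) (hC 3%:R 1) (hC 3%:R 2%:R).
move=> {hT hC} a b d e aT bT dT eT ba da ea db eb ed defc.
rewrite !tr_block_mx !linearN /= aT bT dT eT !mulmx_block !add_block_mx.
rewrite !(mulmxN, mulNmx, opprK) ba da ea db eb ed !scalar_mx_block -{}defc.
rewrite -[0 : 'M_(k + k)](block_mx_const _ _ _ _ 0).
(* Naming the products keeps [mxE] from expanding them into sums, so [ring] only meets linear
   identities between entries. *)
move: (a *m a) (b *m b) (d *m d) (e *m e) (a *m b) (a *m d) (a *m e) (b *m d)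
  (b *m e) (d *m e) => aa bb dd ee ab ad ae bd be de.
by do 2! [congr block_mx]; apply/matrixP => i j; rewrite !mxE; ring.
Qed.

End Williamson.

(** * Families of 0/1 matrices, direct sums and complements *)

Section SquareFamilies.
Variable R : comNzRingType.
Implicit Types (x : 'I_4 -> R) (c : R).

(* The off-diagonal blocks of the complements J - 2X of a direct sum are
   all-ones, so the conditions below only see the diagonal blocks. *)
Definition square_family x c k (X : 'I_4 -> 'M[R]_k) :=
  [/\ forall t i j, X t i j = 0 \/ X t i j = 1,
      forall t, (X t)^T = X t,
      forall t, X t *m const_mx 1 = const_mx (x t) :> 'M_k,
      forall s t, X s *m X t = X t *m X s
    & \sum_t X t *m X t = c%:M].

Lemma square_family_dsum x c k l (X : 'I_4 -> 'M_k) (Y : 'I_4 -> 'M_l) :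
  square_family x c X -> square_family x c Y ->
  square_family x c (fun t => block_mx (X t) 0 0 (Y t)).
Proof.
move=> [X01 XT XJ XC XX] [Y01 YT YJ YC YY]; split.
- move=> t i j; case: (split_ordP i) => {}i ->;
    case: (split_ordP j) => {}j ->;
    rewrite ?(block_mxEul, block_mxEur, block_mxEdl, block_mxEdr) ?mxE //;
    by left.
- by move=> t; rewrite tr_block_mx XT YT !trmx0.
- move=> t; rewrite -!block_mx_const mulmx_block !mul0mx !addr0 !add0r.
  congr block_mx; rewrite ?XJ ?YJ //; apply/matrixP => i j.
  (* The off-diagonal all-ones blocks are rectangular; the entry at [i], [j] is the sum of row [i],
     read off the square case at [i], [i]. *)
  + move/matrixP/(_ i i): (XJ t); rewrite !mxE => <-.
    by apply: eq_bigr => u _; rewrite !mxE.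
  + move/matrixP/(_ i i): (YJ t); rewrite !mxE => <-.
    by apply: eq_bigr => u _; rewrite !mxE.
- move=> s t; rewrite !mulmx_block !mul0mx !mulmx0 !addr0 !add0r.
  by rewrite XC YC.
- rewrite scalar_mx_block -{}XX -{}YY.
  under eq_bigr do
    rewrite mulmx_block !mul0mx !mulmx0 !addr0 !add0r.
  by rewrite !big_ord_recl !big_ord0 !addr0 !add_block_mx !addr0.
Qed.

Lemma square_family_copies x c k (X : 'I_4 -> 'M_k) m :
  square_family x c X -> exists Y : 'I_4 -> 'M_(m * k), square_family x c Y.
Proof.
move=> hX; elim: m => [|m [Y hY]].
  exists (fun=> 0); split=> [t []|t|t|s t|] //;
    by apply/matrixP => - [].
by rewrite mulSn; eexists; apply: square_family_dsum hX hY.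
Qed.

(** The product of [J - 2 X s] and [J - 2 X t] is [4 X s X t] plus [k - 2 (x s + x t)] times [J].
    For [s = t], summing over [t] gives [J] the coefficient [4 k - 4 k = 0]. *)
Lemma square_family_complement x k (X : 'I_4 -> 'M_k) :
  square_family x k%:R X -> \sum_t x t = k%:R ->
  exists A : 'I_4 -> 'M[R]_k,
  [/\ forall t i j, A t i j = 1 \/ A t i j = -1,
      forall t, (A t)^T = A t,
      forall s t, A s *m A t = A t *m A s
    & \sum_t A t *m A t = (4 * k)%:R%:M].
Proof.
move=> [X01 XT XJ XC XX] hx; pose J : 'M[R]_k := const_mx 1.
have JX t : J *m X t = const_mx (x t).
  by rewrite -[LHS]trmxK trmx_mul XT trmx_const XJ trmx_const.
have JJ : J *m J = const_mx k%:R.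
  apply/matrixP => i j; rewrite !mxE.
  by under eq_bigr do rewrite !mxE mulr1; rewrite sumr_const card_ord.
have AA s t : (J - 2%:R *: X s) *m (J - 2%:R *: X t) =
    const_mx (k%:R - 2%:R * (x s + x t)) + 4%:R *: (X s *m X t).
  rewrite mulmxBl !mulmxBr -!scalemxAl -!scalemxAr JJ JX XJ.
  move: (X s *m X t) => P; apply/matrixP => i j; rewrite !mxE; ring.
exists (fun t => J - 2%:R *: X t); split.
- move=> t i j; rewrite !mxE; case: (X01 t i j) => ->.
    by left; rewrite mulr0 subr0.
  by right; rewrite mulr1; ring.
- by move=> t; rewrite linearB linearZ /= XT trmx_const.
- by move=> s t; rewrite !AA XC [x s + _]addrC.
- under eq_bigr do rewrite AA.
  rewrite big_split /= -scaler_sumr XX; apply/matrixP => i j.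
  rewrite !mxE summxE; under eq_bigr do rewrite mxE.
  rewrite sumrB sumr_const card_ord -mulr_sumr big_split /= hx natrM.
  by rewrite -mulr_natr -mulrnAr; ring.
Qed.

End SquareFamilies.

(** * Circulant families checked by computation *)

(** The entry depends on [i - j] modulo [k]; the subtraction [k - j] does not truncate for the
    indices [j < k] in use. *)
Definition circ k (s : seq bool) (i j : nat) : nat :=
  nth false s ((i + (k - j)) %% k).

Definition circ_mul k (s t : seq bool) i j : nat :=
  sumn [seq circ k s i u * circ k t u j | u <- iota 0 k]%N.

(** A computable test for [square_family] over ['F_7]: symmetry and commutation are compared exactly
    in [nat], row sums and the sum of squares modulo 7. *)
Definition circ_check k (rows : seq (seq bool)) (x : seq nat) (c : nat) :=
  let X t := nth [::] rows t in
  let I4 := iota 0 4 in let Ik := iota 0 k in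
  all (fun i => all (fun j =>
    [&& all (fun t => circ k (X t) i j == circ k (X t) j i) I4,
        all (fun t => sumn [seq circ k (X t) i u | u <- Ik]
                        == nth 0 x t %[mod 7])%N I4,
        all (fun s => all (fun t =>
          circ_mul k (X s) (X t) i j == circ_mul k (X t) (X s) i j) I4) I4
      & sumn [seq circ_mul k (X t) (X t) i j | t <- I4]
          == (i == j) * c %[mod 7]]%N) Ik) Ik.

Lemma sum_ord_sumn n (F : nat -> nat) :
  (\sum_(i < n) F i)%N = sumn [seq F i | i <- iota 0 n].
Proof. by rewrite sumnE big_map -(big_mkord xpredT) /index_iota subn0. Qed.

Lemma eqn_mod_natr p (a b : nat) :
  prime p -> a = b %[mod p] -> a%:R = b%:R :> 'F_p.
Proof. by move=> pp e; rewrite -(Fp_nat_mod pp a) e Fp_nat_mod. Qed.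

Lemma circ_family k rows x c : circ_check k rows x c ->
  square_family (fun t : 'I_4 => (nth 0 x t)%:R : 'F_7)%N c%:R
    (fun t => \matrix_(i < k, j < k) (circ k (nth [::] rows t) i j)%:R).
Proof.
move=> /allP chk; set X : 'I_4 -> 'M['F_7]_k := fun t : 'I_4 => \matrix_(i, j) _.
have inI n (i : 'I_n) : (i : nat) \in iota 0 n by rewrite mem_iota /= add0n.
have {chk} chk (i j : 'I_k) := and4P (allP (chk i (inI _ i)) j (inI _ j)).
have XM s t i j : (X s *m X t) i j
    = (circ_mul k (nth [::] rows s) (nth [::] rows t) i j)%:R.
  rewrite !mxE /circ_mul -sum_ord_sumn natr_sum.
  by apply: eq_bigr => u _; rewrite !mxE natrM.
split=> [t i j|t|t|s t|].
- by rewrite mxE /circ; case: nth; [right | left].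
- apply/matrixP => i j; rewrite !mxE.
  by have [/allP /(_ t (inI _ t)) /eqP -> _ _ _] := chk i j.
- apply/matrixP => i j; rewrite !mxE.
  under eq_bigr do rewrite !mxE mulr1.
  rewrite -natr_sum (sum_ord_sumn _ (circ k _ i)).
  apply: eqn_mod_natr => //; apply/eqP.
  by have [_ /allP /(_ t (inI _ t))] := chk i j.
- apply/matrixP => i j; rewrite !XM.
  have [_ _ /allP /(_ s (inI _ s)) /allP /(_ t (inI _ t)) /eqP -> _] := chk i j.
  by [].
- apply/matrixP => i j; rewrite summxE !mxE.
  under eq_bigr do rewrite XM.
  rewrite -natr_sum (sum_ord_sumn 4 (fun t => let s := nth [::] rows t in circ_mul k s s i j)).
  rewrite -mulrnA mulnC; apply: eqn_mod_natr => //; apply/eqP.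
  by have [_ _ _] := chk i j.
Qed.

(** * From ['F_7] to integer matrices *)

(** Signs lift from ['F_p] to the integers, and congruence modulo [p] is equality of images in
    ['F_p]. *)
Lemma is_MH_of_Fp p n (H : 'M['F_p]_n) : prime p ->
  (forall i j, H i j = 1 \/ H i j = -1) -> H *m H^T = n%:R%:M ->
  exists G : 'M[int]_n, is_MH p G.
Proof.
move=> pp H1 HH; pose G : 'M[int]_n := \matrix_(i, j) (-1) ^+ (H i j != 1).
have GH i j : (G i j)%:~R = H i j.
  rewrite mxE rmorphXn /= rmorphN1; case: (eqVneq (H i j) 1) => [-> //|].
  by case: (H1 i j) => -> //; rewrite eqxx.
exists G; split=> i j.
  by rewrite mxE; case: eqP; [left | right].
apply/eqP; rewrite eqz_mod_dvd (dvdz_pcharf (pchar_Fp pp)) rmorphB /=.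
move/matrixP/(_ i j): HH; rewrite !mxE => HH.
rewrite rmorph_sum rmorphM /= natz -!pmulrn mulr_natr -HH subr_eq0.
apply/eqP; apply: eq_bigr => u _.
by rewrite rmorphM /= GH [G^T _ _]mxE GH [H^T _ _]mxE.
Qed.

Lemma MH7_of_family (x : 'I_4 -> 'F_7) k (X : 'I_4 -> 'M_k) :
  square_family x k%:R X -> \sum_t x t = k%:R ->
  exists H : 'M[int]_(4 * k), is_MH 7 H.
Proof.
move=> hX hx; have [A [A1 AT AC AA]] := square_family_complement hX hx.
have -> : (4 * k = k + k + (k + k))%N by lia.
apply: (@is_MH_of_Fp 7 _ (williamson A)) => //.
  exact: williamson_entries.
rewrite (williamson_mul_tr AT AC AA).
by congr (_%:R%:M); lia.
Qed.

Lemma Frobenius_7_12 m : (72 <= m)%N -> exists a b, m = (a * 7 + b * 12)%N.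
Proof.
(* As 3 inverts 12 modulo 7, [b = 3 m mod 7] makes [m - 12 b] divisible by 7; [b <= 6] gives
   [12 b <= 72 <= m]. *)
move=> hm; exists ((m - (m * 3) %% 7 * 12) %/ 7)%N, ((m * 3) %% 7)%N.
lia.
Qed.

(* If C_d is the adjacency matrix of i - j = +-d on Z/7, the last three rows are
   C_3, J - C_1 and J - C_2, whose squares add up to 7J + 5I. *)
Definition base7 (w : bool) : seq (seq bool) :=
  [:: [:: w; false; false; false; false; false; false];
      [:: false; false; false; true; true; false; false];
      [:: true; false; true; true; true; true; false];
      [:: true; true; false; true; true; false; true]].

(* Found by computer search among symmetric circulants. *)
Definition base12 (w : bool) : seq (seq bool) :=
  [:: w :: nseq 11 false;
      [:: false; false; false; false; true; false; false; false; true; false;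
          false; false];
      [:: false; false; false; true; true; false; true; false; true; true;
          false; false];
      nseq 12 true].

Theorem theorem4p8 (n : nat) (hn : (45 * 10 ^ 35 <= n)%N) (hdvd : (4 %| n)%N) :
  exists H : 'M[int]_n, is_MH 7 H.
Proof.
(* 288 is 4 times the bound 72 of [Frobenius_7_12]. Comparing exponents avoids evaluating [10 ^ 35]
   in unary. *)
have {hn} n288 : (288 <= n)%N.
  have h : (45 * 10 ^ 1 <= 45 * 10 ^ 35)%N by rewrite leq_mul2l leq_exp2l.
  exact: leq_trans (leq_trans (isT : 288 <= 45 * 10 ^ 1)%N h) hn.
move: n288; case/dvdnP: hdvd => m -> {n}; rewrite mulnC => hm.
have {hm} hm : (72 <= m)%N by lia.
suff [x [X] [hX hx]] : exists x (X : 'I_4 -> 'M['F_7]_m),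
    square_family x m%:R X /\ \sum_t x t = m%:R.
  exact: MH7_of_family hX hx.
rewrite -(Fp_nat_mod (isT : prime 7) m); set r := (m %% 7)%N.
have [r4 | r5] := leqP r 4.
  (* Copies of a family of size 1: [X t] is the identity for [t < r] and 0 otherwise, so exactly [r]
     squares contribute. *)
  exists (fun t => (nth 0 [seq (i < r : nat)%N | i <- iota 0 4] t)%:R)%N.
  have chk : circ_check 1 [seq [:: (i < r)%N] | i <- iota 0 4]
      [seq (i < r : nat)%N | i <- iota 0 4] r.
    by move: r r4; do 5! case=> //.
  have [Y hY] := square_family_copies m (circ_family chk).
  rewrite muln1 in Y hY; exists Y; split=> //.
  rewrite -natr_sum sum_ord_sumn; congr _%:R.
  by move: r r4 {chk hY}; do 5! case=> //.
have {r5} [w rw] : exists w : bool, r = (w + 5)%N.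
  by exists (r == 6); have := ltn_pmod m (isT : 0 < 7)%N; rewrite -/r; lia.
have chk7 : circ_check 7 (base7 w) [:: (w : nat); 2; 5; 5] r.
  by rewrite rw; case: w {rw}; vm_compute.
(* The all-ones matrix of size 12 has row sum 12, which is 5 modulo 7, so the row sums match those
   of size 7, as the direct sum requires. *)
have chk12 : circ_check 12 (base12 w) [:: (w : nat); 2; 5; 5] r.
  by rewrite rw; case: w {rw chk7}; vm_compute.
have [a [b ->]] := Frobenius_7_12 hm.
have [Y hY] := square_family_copies a (circ_family chk7).
have [Z hZ] := square_family_copies b (circ_family chk12).
eexists; eexists; split; first exact: square_family_dsum hY hZ.
(* The row sums add up to [w + 12], congruent to [w + 5 = r] modulo 7. *)
rewrite -natr_sum sum_ord_sumn; apply: eqn_mod_natr => //.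
by rewrite rw; case: w {rw chk7 chk12 Y hY Z hZ}.
Qed.
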